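(* Let $q$ be a prime power and let $d\ge 5$ be an odd integer. If $S$ is an Erdős-Ko-Rado set of generators of the Hermitian polar space $H(2d-1,q^2)$, then $$|S|\le \bigl((q^2+q+1)q^{2d-3}+1\bigr)\prod_{\substack{1\le i\le d-1\\ 2i\ne d-1,\ 2i\neq d+1}}(q^{2i-1}+1).$$
   Context: $H(2d-1,q^2)$ denotes the Hermitian polar space of rank $d$: it consists of the nonzero totally isotropic subspaces of a $2d$-dimensional vector space over $\mathbb{F}_{q^2}$ equipped with a non-degenerate Hermitian form. Its generators are the maximal totally isotropic subspaces; they all have vector space dimension $d$. An Erdős-Ko-Rado set of generators is a set $S$ of generators such that any two elements of $S$ have non-trivial intersection, i.e. $G\cap G'\neq\{0\}$ for all $G,G'\in S$. *)

(* Defs.v *)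
From HB Require Import structures.
From mathcomp Require Import all_boot all_order all_algebra all_field.

Set Implicit Arguments.
Unset Strict Implicit.
Unset Printing Implicit Defensive.

Import GRing.Theory.
Local Open Scope ring_scope.

Definition prime_power (q : nat) : Prop :=
  exists p k : nat, [/\ prime p, (0 < k)%N & q = (p ^ k)%N].

Section FiniteVspace.
Import VectorInternalTheory.
Variables (F : finFieldType) (vT : vectType F).

HB.instance Definition _ := [Countable of {vspace vT} by <:].
HB.instance Definition _ := [Finite of {vspace vT} by <:].

End FiniteVspace.

Section PolarSpace.
Variables (F : finFieldType) (theta : {rmorphism F -> F}) (vT : vectType F).
Variable form : {hermitian vT for false & theta}.

Definition totally_isotropic (U : {vspace vT}) : bool :=
  (U <= orthov form U)%VS.

Definition polar_subspace (U : {vspace vT}) : bool :=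
  (U != 0%VS) && totally_isotropic U.

Definition generator (U : {vspace vT}) : Prop :=
  polar_subspace U /\
  forall W : {vspace vT}, polar_subspace W -> (U <= W)%VS -> W = U.

Definition EKR_set (S : {set {vspace vT}}) : Prop :=
  {in S, forall G, generator G} /\
  {in S &, forall G G', (G :&: G')%VS != 0%VS}.

End PolarSpace.

(* Main.v *)
Require Import Defs.
From mathcomp Require Import all_boot all_order all_algebra all_field.
From mathcomp Require Import zify ring lra.

(** The bound is a ratio bound of Hoffman type for a weighted version of the
    graph in which two generators are joined when they are disjoint.

    Two generators are related by the dimension of their intersection, and the
    graph of the pairs meeting in dimension [d - 1] is distance regular
    ([neighbour_sum]).  A neighbour of [x] is determined by any of its vectors
    outside [x], so neighbours are counted through isotropic vectors, and these
    through the fibres of the trace map of the field extension.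

    In the basis of functions [qbin Q m i], the number of [i]-subspaces of an
    [m]-space, the graph acts by a bidiagonal matrix ([neighbour_op_qbin]).
    This shows its eigenvalues [theta 0, ..., theta d] and expresses the matrix
    of every relation as a polynomial in the graph.  For the relation of meeting
    trivially the polynomial takes the value
    [(-1)^j q^(j (j - 1) + (d - j)^2)] at [theta j] ([opposite_poly_eval]).

    For odd [d] this relation alone has its least eigenvalue at [j = d], and the
    resulting bound is weak.  Subtracting a positive multiple of the relation of
    meeting in dimension 2 does not spoil the argument, since an
    Erdos-Ko-Rado set only sees entries that are zero or negative, and it raises
    the value at [theta d].  The multiple is chosen so that the values at
    [theta 1] and [theta d] agree.  This common value is then the least one
    ([ekr_poly_ge]), and the bound obtained from it is exactly the product in
    the theorem ([ekr_balance], [qpoch_product]).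

    Semidefiniteness is used in a rational form ([horner_mx_psd]): a polynomial
    that is nonnegative at all [theta j] agrees, modulo the polynomial that
    kills the graph, with a nonnegative combination of squares. *)

Set Implicit Arguments.
Unset Strict Implicit.
Unset Printing Implicit Defensive.

Import Order.TTheory GRing.Theory Num.Theory.
Local Open Scope ring_scope.

(** * Trace and norm of a quadratic extension of finite fields *)

(** There are at most [l] fibres, each with at most [k] elements, so a domain of
    size [k * l] forces equality everywhere. *)
Lemma card_fiber_extremal (aT rT : finType) (f : aT -> rT)
    (A : {set aT}) (B : {set rT}) (k l : nat) :
    {in A, forall a, f a \in B} ->
    {in B, forall b, (#|[set a in A | f a == b]| <= k)%N} ->
    #|A| = (k * l)%N -> (#|B| <= l)%N ->
  {in B, forall b, #|[set a in A | f a == b]| = k}.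
Proof.
move=> fAB le_k cardA leB.
have cardAE : #|A| = (\sum_(b in B) #|[set a in A | f a == b]|)%N.
  rewrite -sum1_card (partition_big f (mem B)) //=.
  apply: eq_bigr => b _; rewrite -sum1_card.
  by apply: eq_bigl => a; rewrite inE.
have [leS eqS] := leqif_sum (fun b (Bb : b \in B) => leqif_eq (le_k b Bb)).
have : (\sum_(b in B) #|[set a in A | f a == b]| == \sum_(b in B) k)%N.
  rewrite eqn_leq leS -cardAE cardA sum_nat_const [X in (_ <= X)%N]mulnC.
  by rewrite leq_mul2r leB orbT.
by rewrite eqS => /forall_inP eqk b Bb; apply/eqP/eqk.
Qed.

Lemma card_lt_size_poly (F : finFieldType) (p : {poly F}) (A : {set F}) :
  p != 0 -> {in A, forall x, root p x} -> (#|A| < size p)%N.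
Proof.
move=> p_neq0 rootA; rewrite cardE; apply: max_poly_roots => //.
  by apply/allP => x; rewrite mem_enum; apply: rootA.
exact: enum_uniq.
Qed.

Section QuadraticExtension.

Variables (q : nat) (F : finFieldType) (theta : {rmorphism F -> F}).
Hypothesis q_gt1 : (1 < q)%N.
Hypothesis cardF : #|F| = (q ^ 2)%N.
Hypothesis thetaE : forall x : F, theta x = x ^+ q.

Lemma thetaK (x : F) : theta (theta x) = x.
Proof. by rewrite !thetaE -exprM -(expnS q 1) -cardF expf_card. Qed.

Lemma size_Xn_add (n : nat) (a : {poly F}) :
  (size a <= n)%N -> size ('X^n + a) = n.+1.
Proof. by move=> lea; rewrite size_polyDl ?size_polyXn // ltnS. Qed.

(** A fibre consists of roots of ['X^q + 'X - e], there are at most [q] possible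
    values because these are roots of ['X^q - 'X], and [F] has [q * q] elements. *)
Lemma card_trace_fiber (e : F) : theta e = e ->
  #|[set c : F | c + theta c == e]| = q.
Proof.
move=> eK; pose Fix := [set x : F | theta x == x].
have := @card_fiber_extremal _ _ (fun c => c + theta c) [set: F] Fix q q.
move=> /(_ _ _ _ _ e) H; rewrite -[RHS]H ?inE ?eK //.
- by apply: eq_card => c; rewrite !inE.
- by move=> c _; rewrite inE rmorphD /= thetaK addrC.
- move=> b _; rewrite -ltnS.
  have sz : size ('X^q + ('X - b%:P) : {poly F}) = q.+1.
    by rewrite size_Xn_add // size_XsubC.
  rewrite -sz; apply: card_lt_size_poly => [|x].
    by rewrite -size_poly_eq0 sz.
  rewrite !inE thetaE => /eqP xb; rewrite /root !hornerE.
  by rewrite /= [_ + x]addrC xb subrr.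
- by rewrite cardsT cardF.
rewrite -ltnS.
have sz : size ('X^q + (- 'X) : {poly F}) = q.+1.
  by rewrite size_Xn_add // size_polyN size_polyX.
rewrite -sz; apply: card_lt_size_poly => [|x].
  by rewrite -size_poly_eq0 sz.
by rewrite !inE thetaE => /eqP xb; rewrite /root !hornerE xb subrr.
Qed.

(** The same extremal count as for the trace, on the [(q + 1) * (q - 1)] nonzero
    elements: fibres lie in the roots of ['X^(q+1) - b], and the values in the
    roots of ['X^(q-1) - 1]. *)
Lemma norm_surjective (e : F) : theta e = e -> exists a, a * theta a = e.
Proof.
have [-> _|e0 eK] := eqVneq e 0; first by exists 0; rewrite mul0r.
pose Fix := [set x : F | (x != 0) && (theta x == x)].
have := @card_fiber_extremal _ _ (fun c => c * theta c) [set~ 0] Fix q.+1 q.-1.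
move=> /(_ _ _ _ _ e) H.
have : #|[set a in [set~ 0] | a * theta a == e]| = q.+1.
  apply: H; rewrite ?inE ?e0 ?eK ?eqxx //.
  - move=> c; rewrite !inE => c0.
    by rewrite mulf_neq0 ?fmorph_eq0 // rmorphM /= thetaK mulrC eqxx.
  - move=> b _; rewrite -ltnS.
    have sz : size ('X^(q.+1) - b%:P : {poly F}) = q.+2 by rewrite size_XnsubC.
    rewrite -sz; apply: card_lt_size_poly => [|x].
      by rewrite -size_poly_eq0 sz.
    rewrite !inE thetaE => /andP[_ /eqP <-].
    by rewrite /root !hornerE -exprS subrr.
  - by rewrite cardsC1 cardF; nia.
  have sz : size ('X^(q.-1) - 1%:P : {poly F}) = q.
    by rewrite size_XnsubC; lia.
  have q0 : (0 < q)%N by lia.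
  rewrite -ltnS prednK // -[X in (_ < X)%N]sz; apply: card_lt_size_poly => [|x].
    by rewrite -size_poly_eq0 sz; lia.
  rewrite !inE thetaE => /andP[x0 /eqP xq]; rewrite /root !hornerE.
  by rewrite subr_eq0 -(inj_eq (mulfI x0)) -exprS prednK // xq mulr1.
move=> cardq.
have /card_gt0P[a] : (0 < #|[set a in [set~ 0%R] | (a * theta a)%R == e]|)%N.
  by rewrite cardq.
by rewrite !inE => /andP[_ /eqP <-]; exists a.
Qed.

End QuadraticExtension.

(** * Orthogonal complements *)

Section Perp.

Variables (F : fieldType) (theta : {rmorphism F -> F}) (vT : vectType F).
Variable form : {hermitian vT for false & theta}.
Local Notation perp := (orthov form).

Lemma hermE u v : form u v = theta (form v u).
Proof. by rewrite hermC expr0 mul1r. Qed.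

Lemma perpS U V : (U <= V)%VS -> (perp V <= perp U)%VS.
Proof.
move=> /subvP sUV; apply/subvP => w /mem_orthovP wV.
by apply/mem_orthovP => u /sUV; apply: wV.
Qed.

Lemma perpD U V : perp (U + V)%VS = (perp U :&: perp V)%VS.
Proof.
apply/eqP; rewrite eqEsubv subv_cap !perpS ?addvSl ?addvSr //=.
by rewrite orthovD capvSl capvSr.
Qed.

Lemma leq_dim_cap_perp U V : (\dim V <= \dim (V :&: perp U) + \dim U)%N.
Proof.
suff le_span X : (\dim V <= \dim (V :&: perp <<X>>) + size X)%N.
  by have := le_span (vbasis U); rewrite (span_basis (vbasisP U)) size_tuple.
elim: X V => [|x X IH] V /=; first by rewrite span_nil orthov0 capvf addn0.
rewrite span_cons perpD capvA.
have := IH (V :&: perp <[x]>)%VS; have := leq_dim_orthov1 form x V.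
lia.
Qed.

(** Row rank equals column rank for the pairing of [V] with [U].  One inequality
    suffices by symmetry; it is [leq_dim_cap_perp] for a complement of the part
    of one space that is orthogonal to the other. *)
Lemma dim_cap_perp U V :
  (\dim (V :&: perp U) + \dim U = \dim (U :&: perp V) + \dim V)%N.
Proof.
suff le A B : (\dim B + \dim (A :&: perp B) <= \dim (B :&: perp A) + \dim A)%N.
  by have := le U V; have := le V U; lia.
pose A1 := (A :\: (A :&: perp B))%VS.
have -> : (B :&: perp A = B :&: perp A1)%VS.
  have -> : perp A = (perp A1 :&: perp (A :&: perp B))%VS.
    rewrite -perpD -[in LHS](addv_diff_cap A (A :&: perp B)).
    by rewrite [(A :&: (A :&: _))%VS]capvA capvv.
  rewrite [(perp A1 :&: _)%VS]capvC capvA; congr (_ :&: _)%VS.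
  by apply/capv_idPl; rewrite orthov_sym capvSr.
have := leq_dim_cap_perp A1 B.
have := dimv_cap_compl A (A :&: perp B).
rewrite -/A1 capvA capvv; lia.
Qed.

Lemma dim_perp U : nondegenerate form ->
  (\dim (perp U) + \dim U = \dim {:vT})%N.
Proof.
move=> /eqP nd; have := dim_cap_perp U fullv.
by rewrite capfv nd capv0 dimv0.
Qed.

Lemma isotropic_add_line U w : (U <= perp U)%VS -> w \in perp U ->
  form w w = 0 -> (U + <[w]> <= perp (U + <[w]>))%VS.
Proof.
move=> isoU wU ww; rewrite orthovD !orthoDv.
rewrite isoU [(U <= perp <[w]>)%VS]orthov_sym.
by rewrite -!memvE wU mem_orthov1 ww eqxx.
Qed.

End Perp.

(** * Generators and their neighbours *)

Definition qnum (Q : rat) (n : nat) : rat := (Q ^+ n - 1) / (Q - 1).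

(** The intersection numbers of the dual polar graph of [H(2d-1, q^2)], indexed by
    the dimension [m] of the intersection instead of the distance [d - m]. *)
Definition neighbour_op (q : rat) (d : nat) (f : nat -> rat) (m : nat) : rat :=
  qnum (q ^+ 2) (d - m) * f m.+1
  + (q - 1) * qnum (q ^+ 2) (d - m) * f m
  + q * (q ^+ 2) ^+ (d - m) * qnum (q ^+ 2) m * f m.-1.

Lemma card_vspace_set (F : finFieldType) (vT : vectType F) (U : {vspace vT}) :
  #|[set w : finvect_type vT | (w : vT) \in U]| = (#|F| ^ \dim U)%N.
Proof.
case: vT U => T c U; rewrite cardsE.
exact: (@card_vspace F (finvect_type (Vector.Pack c)) c U).
Qed.

Section Generators.

Variables (q d : nat) (F : finFieldType) (theta : {rmorphism F -> F}).
Variables (vT : vectType F) (form : {hermitian vT for false & theta}).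
Hypothesis q_gt1 : (1 < q)%N.
Hypothesis cardF : #|F| = (q ^ 2)%N.
Hypothesis thetaE : forall x : F, theta x = x ^+ q.
Hypothesis dimV : \dim {:vT} = (2 * d)%N.
Hypothesis nondeg : nondegenerate form.

Local Notation perp := (orthov form).
Local Notation fvT := (finvect_type vT).
Local Notation Q := (q ^ 2)%N.

Lemma totally_isotropic_dim U : totally_isotropic form U -> (\dim U <= d)%N.
Proof. by move=> /dimvS; have := dim_perp U nondeg; rewrite dimV; lia. Qed.

Hypothesis d_gt0 : (0 < d)%N.

(** There are [u] and [v] in the orthogonal complement of [U], outside [U] and
    orthogonal to each other.  If [u] is anisotropic, surjectivity of the norm
    gives an [a] for which [v + a *: u] is isotropic. *)
Lemma exists_isotropic_extension U :
    totally_isotropic form U -> (\dim U < d)%N ->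
  exists w, [/\ w \notin U, w \in perp U & form w w = 0].
Proof.
move=> isoU ltU; have dimU := dim_perp U nondeg; rewrite dimV in dimU.
have pick_out A : (\dim U < \dim A)%N -> exists2 w, w \in A & w \notin U.
  by move=> ltA; apply/subvPn; apply/negP => /dimvS; rewrite leqNgt ltA.
have [u uP uU] : exists2 u, u \in perp U & u \notin U by apply: pick_out; lia.
have [uu|uu] := eqVneq (form u u) 0; first by exists u.
have [v] : exists2 v, v \in (perp U :&: perp <[u]>)%VS & v \notin U.
  by apply: pick_out; have := leq_dim_orthov1 form u (perp U); lia.
rewrite memv_cap mem_orthov1 => /andP[vP /eqP vu] vU.
have uv : form u v = 0 by rewrite hermE vu rmorph0.
have [a aE] : exists a, a * theta a = - form v v / form u u.
  apply: (norm_surjective q_gt1 cardF thetaE).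
  by rewrite fmorph_div rmorphN /= -!hermE.
exists (v + a *: u); split.
- have [->|a0] := eqVneq a 0; first by rewrite scale0r addr0.
  apply/negP => wU; move/mem_orthovP/(_ _ wU): uP.
  by apply/eqP; rewrite linearDr linearZr /= uv add0r mulf_neq0 ?fmorph_eq0.
- by rewrite memvD // memvZ.
rewrite linearDl !linearDr /= !linearZl_LR !linearZr /= vu uv.
have -> : a * (theta a * form u u) = - form v v.
  by rewrite mulrA aE divfK.
by rewrite !mulr0 addr0 add0r subrr.
Qed.

Definition gens : {set {vspace vT}} :=
  [set U | totally_isotropic form U && (\dim U == d)].

(** Maximality yields the dimension, as a smaller totally isotropic subspace could
    be extended by an isotropic vector. *)
Lemma generator_gens U : generator form U -> U \in gens.
Proof.
case=> /andP[U0 isoU] maxU; rewrite inE isoU /=.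
have := totally_isotropic_dim isoU; rewrite leq_eqVlt => /orP[//|ltU].
have [w [wU wP ww]] := exists_isotropic_extension isoU ltU.
have Uw : (U + <[w]>)%VS = U.
  apply: maxU; last exact: addvSl.
  rewrite /polar_subspace /totally_isotropic isotropic_add_line // andbT.
  apply: contraNneq U0 => Uw0; rewrite -subv0 -Uw0; exact: addvSl.
by case/negP: wU; rewrite memvE -Uw addvSr.
Qed.

Lemma gens_perp x : x \in gens -> perp x = x.
Proof.
rewrite inE => /andP[isox /eqP dimx]; apply/esym/eqP.
rewrite eqEdim (isox : (x <= perp x)%VS) /=.
by have := dim_perp x nondeg; rewrite dimV dimx; lia.
Qed.

Lemma gens_dim x : x \in gens -> \dim x = d.
Proof. by rewrite inE => /andP[_ /eqP]. Qed.

Lemma card_vspaceD (U W : {vspace vT}) :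
  #|[set w : fvT | ((w : vT) \in U) && ((w : vT) \notin W)]|
  = (Q ^ \dim U - Q ^ \dim (U :&: W))%N.
Proof.
rewrite -cardF -!card_vspace_set.
have -> : [set w : fvT | ((w : vT) \in U) && ((w : vT) \notin W)] =
   [set w : fvT | (w : vT) \in U] :\: [set w : fvT | (w : vT) \in (U :&: W)%VS].
  by apply/setP => w; rewrite !inE memv_cap; case: (_ \in U); rewrite ?andbF ?andbT.
rewrite cardsD; congr (_ - #|pred_of_set _|)%N.
by apply/setP => w; rewrite !inE memv_cap andbA andbb.
Qed.

Definition adjacent (x z : {vspace vT}) := \dim (x :&: z) == d.-1.

(** A neighbour of [x] is [neighbour_through x w] for each of its vectors [w]
    outside [x], which turns counts of neighbours into counts of isotropic
    vectors. *)
Definition neighbour_through (x : {vspace vT}) (w : vT) : {vspace vT} :=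
  (x :&: perp <[w]> + <[w]>)%VS.

Lemma dim_cap_perp_line x w : x \in gens -> w \notin x ->
  \dim (x :&: perp <[w]>) = d.-1.
Proof.
by move=> gx wx; rewrite -eq_dim_orthov1 ?(gens_dim gx) // (gens_perp gx).
Qed.

Lemma neighbour_through_gens x w : x \in gens -> w \notin x -> form w w = 0 ->
  neighbour_through x w \in gens.
Proof.
move=> gx wx ww; have dimH := dim_cap_perp_line gx wx.
have wH : w \in perp (x :&: perp <[w]>) by rewrite memvE orthov_sym capvSr.
have isoH : (x :&: perp <[w]> <= perp (x :&: perp <[w]>))%VS.
  apply: subv_trans (capvSl _ _) _; apply: subv_trans (perpS _ (capvSl _ _)).
  by rewrite (gens_perp gx).
rewrite inE /totally_isotropic isotropic_add_line //=.
rewrite dimv_disjoint_sum ?dimH ?dim_vline.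
  have -> : w != 0 by apply: contraNneq wx => ->; rewrite mem0v.
  by rewrite addn1 prednK.
apply/eqP; rewrite -subv0; apply/subvP => v; rewrite memv_cap => /andP[vx /vlineP[a va]].
have [a0|a0] := eqVneq a 0; first by rewrite va a0 scale0r mem0v.
move: vx; rewrite memv_cap => /andP[vx _].
by case/negP: wx; rewrite -[w](scalerK a0) -va memvZ.
Qed.

Lemma neighbour_through_cap x w : x \in gens -> w \notin x ->
  (x :&: neighbour_through x w = x :&: perp <[w]>)%VS.
Proof.
move=> gx wx; apply/eqP; rewrite eqEsubv [X in _ && X]subv_cap capvSl addvSl !andbT.
apply/subvP => v; rewrite memv_cap => /andP[vx /memv_addP[h hH [u /vlineP[a ->] vE]]].
have [a0|a0] := eqVneq a 0; first by rewrite vE a0 scale0r addr0.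
case/negP: wx; rewrite -[w](scalerK a0) memvZ //.
move: hH; rewrite memv_cap => /andP[hx _].
have -> : a *: w = v - h by rewrite vE addrC addKr.
by rewrite memvB.
Qed.

Lemma neighbour_through_adjacent x w : x \in gens -> w \notin x ->
  adjacent x (neighbour_through x w).
Proof. by move=> gx wx; rewrite /adjacent neighbour_through_cap // dim_cap_perp_line. Qed.

Lemma mem_neighbour_through x w : w \in neighbour_through x w.
Proof. by rewrite memvE addvSr. Qed.

Lemma gens_form z v w : z \in gens -> v \in z -> w \in z -> form v w = 0.
Proof. by rewrite inE => /andP[/orthovP zz _]; apply: zz. Qed.

Lemma adjacent_neighbour_through x z w : x \in gens -> z \in gens -> adjacent x z ->
  w \in z -> w \notin x -> neighbour_through x w = z.
Proof.
move=> gx gz /eqP dimxz wz wx; apply/eqP.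
have /gens_dim dimT : neighbour_through x w \in gens.
  by rewrite neighbour_through_gens // (gens_form gz wz wz).
rewrite eqEdim dimT (gens_dim gz) leqnn andbT subv_add -memvE wz andbT.
suff <- : (x :&: z = x :&: perp <[w]>)%VS by rewrite capvSr.
apply/eqP; rewrite eqEdim dimxz dim_cap_perp_line // leqnn andbT.
rewrite subv_cap capvSl /=; apply/subvP => v; rewrite memv_cap => /andP[_ vz].
by rewrite mem_orthov1 (gens_form gz vz wz).
Qed.

(** An isotropic vector outside [x] lies in exactly one neighbour of [x]. *)
Lemma double_count_neighbours x (P : pred vT) : x \in gens ->
  (\sum_(z in gens | adjacent x z)
     #|[set w : fvT | [&& (w : vT) \in z, (w : vT) \notin x & P w]]|
   = #|[set w : fvT | [&& form w w == 0%R, (w : vT) \notin x & P w]]|)%N.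
Proof.
move=> gx; rewrite -[RHS]sum1_card.
rewrite (partition_big (neighbour_through x) (fun z => (z \in gens) && adjacent x z)) /=.
  apply: eq_bigr => z /andP[gz xz]; rewrite -sum1_card; apply: eq_bigl => w.
  rewrite !inE; case wx: (_ \in x); first by rewrite !andbF.
  case Pw: (P w); rewrite ?andbF // !andbT.
  apply/idP/andP => [wz|[_ /eqP <-]]; last exact: mem_neighbour_through.
  by rewrite (gens_form gz wz wz) eqxx (adjacent_neighbour_through gx gz xz wz) ?wx.
move=> w; rewrite inE => /and3P[/eqP ww wx _].
by rewrite neighbour_through_gens // neighbour_through_adjacent.
Qed.

(** * Counting neighbours *)

Lemma card_set_translate (P : pred fvT) (t : fvT) :
  #|[set a : fvT | P (a + t)]| = #|[set a | P a]|.
Proof.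
by rewrite -(card_preimset [set a | P a] (addIr t)); apply: eq_card => a; rewrite !inE.
Qed.

(** The functional [form _ w] is nonzero on [x], because [x] is its own orthogonal
    complement; its fibres are translates of a kernel of dimension [d - 1]. *)
Lemma card_form_fiber x w c : x \in gens -> w \notin x ->
  #|[set a : fvT | ((a : vT) \in x) && (form a w == c)]| = (Q ^ d.-1)%N.
Proof.
move=> gx wx.
have [v vx wv] : exists2 v, v \in x & form w v != 0.
  by apply/mem_orthovPn; rewrite gens_perp.
pose a0 : fvT := (c / form v w) *: v.
have a0x : a0 \in x by apply: memvZ.
have a0w : form a0 w = c by rewrite linearZl_LR /= divfK // herm_eq0C.
rewrite -(card_set_translate _ a0) -(dim_cap_perp_line gx wx) -cardF -card_vspace_set.
apply: eq_card => a; rewrite !inE memv_cap mem_orthov1.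
have -> : form (a + a0) w = form a w + c by rewrite -a0w; apply: linearDl.
have -> : ((a + a0 : vT) \in x) = ((a : vT) \in x) by apply: rpredDr.
by rewrite // -[X in _ == X]add0r (inj_eq (addIr c)).
Qed.

(** As [x] is totally isotropic, [form (w + a) (w + a)] is [form w w] plus the
    trace of [form a w].  It vanishes on [q] fibres of [form _ w]. *)
Lemma card_isotropic_coset x w : x \in gens -> w \notin x ->
  #|[set a : fvT | ((a : vT) \in x) && (form (w + a) (w + a) == 0)]|
  = (q * Q ^ d.-1)%N.
Proof.
move=> gx wx; set e := - form w w.
have eE : theta e = e by rewrite rmorphN /= -hermE.
rewrite -[X in _ = (X * _)%N](card_trace_fiber q_gt1 cardF thetaE eE) -sum1_card.
pose fiber := [set c : F | c + theta c == e].
rewrite (partition_big (fun a : fvT => form a w) (mem fiber)) /=.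
  rewrite -sum_nat_const; apply: eq_bigr => c; rewrite inE => ce.
  rewrite -(card_form_fiber c gx wx) -sum1_card.
  apply: eq_bigl => a; rewrite !inE; case ax: (_ \in x) => //=.
  have [ac|ac] := eqVneq (form a w) c; rewrite ?andbF // andbT.
  rewrite linearDl !linearDr /= (gens_form gx ax ax) addr0 [form w a]hermE.
  by rewrite ac -addrA [theta c + c]addrC (eqP ce) subrr eqxx.
move=> a; rewrite !inE => /andP[ax]; rewrite linearDl !linearDr /=.
rewrite (gens_form gx ax ax) addr0 [form w a]hermE => /eqP s0.
by rewrite /e -addr_eq0 -[X in _ == X]s0; apply/eqP; ring.
Qed.


(** The part of [perp W] outside [x] is a union of cosets of [x].  Count the pairs
    of a vector [w] in it and an [a] in [x] with [w + a] isotropic: over [w] by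
    [card_isotropic_coset], and over [w + a] as [x] times the set of isotropic
    vectors. *)
Lemma card_isotropic_perp x W : x \in gens -> (W <= x)%VS ->
  #|[set w : fvT | [&& form w w == 0%R, (w : vT) \notin x & (w : vT) \in perp W]]|
  = ((Q ^ (d - \dim W) - 1) * (q * Q ^ d.-1))%N.
Proof.
move=> gx Wx; set I := [set w : fvT | _].
have xW : (x <= perp W)%VS by rewrite -(gens_perp gx) perpS.
pose X := [set a : fvT | (a : vT) \in x].
pose S := [set w : fvT | ((w : vT) \in perp W) && ((w : vT) \notin x)].
have le_mW : (\dim W <= d)%N by rewrite -(gens_dim gx) dimvS.
have cardX : #|X| = (Q ^ d)%N by rewrite card_vspace_set cardF (gens_dim gx).
have cardS : #|S| = (Q ^ d * (Q ^ (d - \dim W) - 1))%N.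
  rewrite card_vspaceD (capv_idPr xW) (gens_dim gx) mulnBr muln1 -expnD.
  by congr (Q ^ _ - _)%N; have := dim_perp W nondeg; rewrite dimV; lia.
have Q_gt0 : (0 < Q ^ d)%N by rewrite expn_gt0; lia.
apply/eqP; rewrite -(eqn_pmul2l Q_gt0) mulnA -cardS -{1}cardX; apply/eqP.
transitivity (\sum_(w in S) \sum_(a in X) (form (w + a)%R (w + a)%R == 0%R))%N; last first.
  rewrite -sum_nat_const; apply: eq_bigr => w; rewrite inE => /andP[_ wx].
  rewrite -(card_isotropic_coset gx wx) -sum1_card -big_mkcondr /=.
  by apply: eq_bigl => a; rewrite !inE.
rewrite exchange_big -sum_nat_const; apply: eq_bigr => a; rewrite inE => ax.
rewrite -(card_set_translate _ a) -sum1_card -big_mkcondr /=.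
apply: eq_bigl => w; rewrite !inE.
have aW : a \in perp W by apply: (subvP xW).
have -> : ((w + a : vT) \in x) = ((w : vT) \in x) by apply: rpredDr.
have -> : ((w + a : vT) \in perp W) = ((w : vT) \in perp W) by apply: rpredDr.
by do 2![case: (_ \in _)]; rewrite ?andbF ?andbT.
Qed.


Lemma neighbour_cap x y z : x \in gens -> y \in gens -> z \in gens ->
    adjacent x z -> (x :&: y <= z)%VS ->
  [/\ (z :&: y :&: x = x :&: y)%VS, (\dim (x :&: y) <= \dim (z :&: y))%N
    & (\dim (z :&: y) <= (\dim (x :&: y)).+1)%N].
Proof.
move=> gx gy gz /eqP xz xyz.
have capE : (z :&: y :&: x = x :&: y)%VS.
  by rewrite -capvA [(y :&: x)%VS]capvC; apply/capv_idPr.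
split=> //; first by rewrite -capE dimvS // capvSl.
have := dimv_sum_cap (z :&: y) (x :&: z).
have -> : (z :&: y :&: (x :&: z) = x :&: y)%VS.
  by rewrite capvA capE; apply/capv_idPl.
have := dimvS (_ : z :&: y + (x :&: z) <= z)%VS.
rewrite subv_add capvSl capvSr => /(_ isT); rewrite (gens_dim gz); lia.
Qed.

(** Let [a] in [x :&: y] be missing from [z].  A vector [w] of [z :&: y] outside [x]
    would be orthogonal to [a], and then [z], the neighbour of [x] through [w],
    would contain [a]. *)
Lemma neighbour_cap_down x y z : x \in gens -> y \in gens -> z \in gens ->
    adjacent x z -> ~~ (x :&: y <= z)%VS ->
  (z :&: y <= x)%VS /\ (\dim (z :&: y)).+1 = \dim (x :&: y).
Proof.
move=> gx gy gz xz /subvPn[a]; rewrite memv_cap => /andP[ax ay] az.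
have zyx : (z :&: y <= x)%VS.
  apply/subvP => w; rewrite memv_cap => /andP[wz wy]; apply: contraNT az => wx.
  rewrite -(adjacent_neighbour_through gx gz xz wz wx).
  apply: (subvP (addvSl _ _)).
  by rewrite memv_cap ax mem_orthov1 (gens_form gy ay wy) eqxx.
split=> //.
have := dimv_sum_cap (x :&: z) (x :&: y).
have -> : (x :&: z :&: (x :&: y) = z :&: y)%VS.
  apply/eqP; rewrite eqEsubv !subv_cap zyx capvSl capvSr !andbT.
  rewrite (subv_trans (capvSl _ _) (capvSr _ _)).
  by rewrite (subv_trans (capvSr _ _) (capvSr _ _)).
have -> : (x :&: z + x :&: y = x)%VS.
  apply/eqP; rewrite eqEdim subv_add !capvSl /= (gens_dim gx).
  have lt : (\dim (x :&: z) < \dim (x :&: z + x :&: y))%N.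
    rewrite (ltn_leqif (dimv_leqif_sup (addvSl _ _))).
    apply: contra az => /subvP sub.
    have : a \in (x :&: z + x :&: y)%VS.
      by apply: (subvP (addvSr _ _)); rewrite memv_cap ax.
    by move/sub; rewrite memv_cap => /andP[].
  by move: lt; rewrite (eqP xz); lia.
rewrite (eqP xz) (gens_dim gx); lia.
Qed.

(** The neighbour of [x] through [w] contains [W] exactly when [w] is orthogonal
    to [W]. *)
Lemma card_neighbours_above x W : x \in gens -> (W <= x)%VS ->
  (#|[set z in gens | adjacent x z && (W <= z)%VS]| * (Q ^ d - Q ^ d.-1)
   = (Q ^ (d - \dim W) - 1) * (q * Q ^ d.-1))%N.
Proof.
move=> gx Wx; rewrite -(card_isotropic_perp gx Wx).
rewrite -(double_count_neighbours (fun w => w \in perp W) gx).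
rewrite -sum_nat_const; under [LHS]eq_bigl => z do rewrite inE andbA.
rewrite [LHS]big_mkcondr; apply: eq_bigr => z /andP[gz xz].
case: ifPn => [Wz|nWz].
  rewrite -(eqP xz) -[X in (_ ^ X - _)%N](gens_dim gz) [(x :&: z)%VS]capvC.
  rewrite -card_vspaceD.
  apply: eq_card => w; rewrite !inE; case wz: (_ \in z) => //=.
  have -> : (w : vT) \in perp W; last by rewrite andbT.
  apply/mem_orthovP => v vW.
  by rewrite (gens_form gz wz) // (subvP Wz).
apply/esym/eqP; rewrite cards_eq0; apply/eqP/setP => w; rewrite !inE.
apply: contraNF nWz => /and3P[wz wx wW].
rewrite -(adjacent_neighbour_through gx gz xz wz wx).
apply: subv_trans (addvSl _ _); rewrite subv_cap Wx /=.
by rewrite orthov_sym -memvE.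
Qed.

(** Every vector of [y] outside [x] lies in one neighbour [z], and such a [z] meets
    [y] in [x :&: y] enlarged by one dimension. *)
Lemma card_neighbours_up x y : x \in gens -> y \in gens ->
  (#|[set z in gens | adjacent x z && (\dim (z :&: y) == (\dim (x :&: y)).+1)]|
    * (Q ^ (\dim (x :&: y)).+1 - Q ^ \dim (x :&: y))
   = Q ^ d - Q ^ \dim (x :&: y))%N.
Proof.
move=> gx gy; rewrite -[X in _ = (_ ^ X - _)%N](gens_dim gy).
rewrite [in RHS]capvC -card_vspaceD.
have -> : [set w : fvT | ((w : vT) \in y) && ((w : vT) \notin x)] =
    [set w : fvT | [&& form w w == 0%R, (w : vT) \notin x & (w : vT) \in y]].
  apply/setP => w; rewrite !inE; case wy: (_ \in y); last by rewrite !andbF.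
  by rewrite (gens_form gy wy wy) eqxx andbT.
rewrite -(double_count_neighbours (fun w => w \in y) gx).
rewrite -sum_nat_const; under [LHS]eq_bigl => z do rewrite inE andbA.
rewrite [LHS]big_mkcondr; apply: eq_bigr => z /andP[gz xz].
have -> : [set w : fvT | [&& (w : vT) \in z, (w : vT) \notin x & (w : vT) \in y]]
   = [set w : fvT | ((w : vT) \in (z :&: y)%VS) && ((w : vT) \notin x)].
  by apply/setP => w; rewrite !inE memv_cap -andbA [(_ \notin x) && _]andbC.
rewrite card_vspaceD.
have [xyz|nxyz] := boolP (x :&: y <= z)%VS.
  have [-> le1 le2] := neighbour_cap gx gy gz xz xyz.
  case: eqP => [->|ne] //.
  have -> : \dim (z :&: y) = \dim (x :&: y) by lia.
  by rewrite subnn.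
have [zyx dimE] := neighbour_cap_down gx gy gz xz nxyz.
by rewrite (capv_idPl zyx) subnn; case: eqP => // ; lia.
Qed.


(** Distance regularity of the dual polar graph, tested against an arbitrary
    function [f] of the dimension. *)
Lemma neighbour_sum x y (f : nat -> rat) : x \in gens -> y \in gens ->
  \sum_(z in gens | adjacent x z) f (\dim (z :&: y))
  = neighbour_op q%:R d f (\dim (x :&: y)).
Proof.
move=> gx gy; set m := \dim (x :&: y).
have le_md : (m <= d)%N by rewrite -(gens_dim gx) dimvS // capvSl.
pose N := #|[set z in gens | adjacent x z]|.
pose N2 := #|[set z in gens | adjacent x z && (x :&: y <= z)%VS]|.
pose N1 := #|[set z in gens | adjacent x z && (\dim (z :&: y) == m.+1)]|.
(* Dimensions m + 1, m and m - 1 occur N1, N2 - N1 and N - N2 times. *)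
have sumE : \sum_(z in gens | adjacent x z) f (\dim (z :&: y)) =
   N1%:R * f m.+1 + (N2%:R - N1%:R) * f m + (N%:R - N2%:R) * f m.-1.
  have -> : N1%:R = \sum_(z in gens | adjacent x z)
                      (\dim (z :&: y) == m.+1)%:R :> rat.
    rewrite /N1 -sum1_card natr_sum big_mkcond [RHS]big_mkcond.
    by apply: eq_bigr => z _; rewrite inE andbA; case: (_ && adjacent _ _) => //=; case: eqP.
  have -> : N2%:R = \sum_(z in gens | adjacent x z) (x :&: y <= z)%VS%:R :> rat.
    rewrite /N2 -sum1_card natr_sum big_mkcond [RHS]big_mkcond.
    by apply: eq_bigr => z _; rewrite inE andbA; case: (_ && adjacent _ _) => //=;
       case: (_ <= _)%VS.
  have -> : N%:R = \sum_(z in gens | adjacent x z) 1 :> rat.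
    by rewrite /N -sum1_card natr_sum; apply: eq_bigl => z; rewrite inE.
  rewrite -!sumrB !mulr_suml -!big_split /=; apply: eq_bigr => z /andP[gz xz].
  have [xyz|nxyz] := boolP (x :&: y <= z)%VS.
    have [_ le1 le2] := neighbour_cap gx gy gz xz xyz; rewrite -/m in le1 le2.
    case: eqP => [->|ne]; first by rewrite /= !subrr !mul0r !addr0 mul1r.
    have -> : \dim (z :&: y) = m by lia.
    by rewrite /= subrr subr0 !mul0r mul1r add0r addr0.
  have [zyx dimE] := neighbour_cap_down gx gy gz xz nxyz; rewrite -/m in dimE.
  have -> : \dim (z :&: y) = m.-1 by rewrite -dimE.
  case: eqP => [/=|_ /=]; first by lia.
  by rewrite !subrr subr0 !mul0r mul1r !add0r.
rewrite sumE /neighbour_op /qnum.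
have dE : (Q ^ d = Q ^ (d - m) * Q ^ m)%N by rewrite -expnD subnK.
have Q_gt1 : (1 < Q)%N by rewrite -(expn0 q) ltn_exp2l.
have Q0 k : (0 < Q ^ k)%N by rewrite expn_gt0; lia.
have E1 : (N1 * (Q ^ m.+1 - Q ^ m) = Q ^ d - Q ^ m)%N by apply: card_neighbours_up.
have E2 := card_neighbours_above gx (capvSl x y).
have E3 := card_neighbours_above gx (sub0v x).
have qR0 : (q%:R : rat) != 0 by rewrite pnatr_eq0; lia.
have QR1 : (q%:R ^+ 2 - 1 : rat) != 0.
  by rewrite -natrX subr_eq0 (eqr_nat _ _ 1); lia.
have QR k : (q%:R ^+ 2) ^+ k != 0 :> rat by rewrite !expf_neq0.
have N1E : N1%:R = ((q%:R ^+ 2) ^+ (d - m) - 1) / (q%:R ^+ 2 - 1) :> rat.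
  have : (N1 * (Q - 1))%N = (Q ^ (d - m) - 1)%N.
    apply/eqP; rewrite -(eqn_pmul2r (Q0 m)) -mulnA !mulnBl !mul1n -dE -expnS.
    by rewrite E1.
  move/(congr1 (fun k => k%:R : rat)).
  rewrite natrM !natrB ?Q0 ?(ltnW Q_gt1) // !natrX => E; apply: (mulIf QR1).
  by rewrite divfK.
have NE W : (W <= x)%VS ->
    #|[set z in gens | adjacent x z && (W <= z)%VS]|%:R
    = q%:R * ((q%:R ^+ 2) ^+ (d - \dim W) - 1) / (q%:R ^+ 2 - 1) :> rat.
  move=> Wx; have /eqP := card_neighbours_above gx Wx.
  have -> : (Q ^ d - Q ^ d.-1 = (Q - 1) * Q ^ d.-1)%N.
    by rewrite mulnBl mul1n -expnS prednK.
  rewrite !mulnA eqn_pmul2r // => /eqP/(congr1 (fun k => k%:R : rat)).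
  rewrite !natrM !natrB ?Q0 ?(ltnW Q_gt1) // !natrX => E; apply: (mulIf QR1).
  by rewrite divfK // E mulrC.
have N2E := NE _ (capvSl x y); rewrite -/m -/N2 in N2E.
have N3E := NE _ (sub0v x); rewrite dimv0 subn0 in N3E.
have {N3E}NE : N%:R = q%:R * ((q%:R ^+ 2) ^+ d - 1) / (q%:R ^+ 2 - 1) :> rat.
  rewrite -N3E; congr (#|pred_of_set _|%:R); apply/setP => z.
  by rewrite !inE sub0v andbT.
rewrite N1E N2E NE -[in (_ ^+ 2) ^+ d](subnK le_md) exprD.
by field.
Qed.

End Generators.

(** * Positivity by interpolation *)

Section Interpolation.

Variables (R : realFieldType) (n : nat) (A : 'M[R]_n.+1).
Hypothesis symA : A^T = A.

Lemma trmx_horner_mx (p : {poly R}) : (horner_mx A p)^T = horner_mx A p.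
Proof.
elim/poly_ind: p => [|p c IH]; first by rewrite rmorph0 trmx0.
rewrite rmorphD rmorphM /= horner_mx_X horner_mx_C linearD /= tr_scalar_mx.
rewrite [X in X + _](trmx_mul (horner_mx A p) A) IH symA.
by rewrite [A *m _](comm_mx_horner p (erefl : comm_mx A A)).
Qed.

Lemma quadratic_form_sum m (B : 'M[R]_(1, m)) : 0 <= (B *m B^T) 0 0.
Proof. by rewrite mxE sumr_ge0 // => i _; rewrite mxE -expr2 sqr_ge0. Qed.

(** Modulo the polynomial that kills [A], the polynomial [w] agrees with an
    interpolant at the points of [rs] that is a combination of squares [L r ^+ 2]
    with coefficients of the sign of [w.[r]], where [L r] vanishes at the points
    other than [r]. *)
Lemma horner_mx_psd (rs : seq R) (w : {poly R}) (x : 'rV[R]_n.+1) :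
    uniq rs -> horner_mx A (\prod_(r <- rs) ('X - r%:P)) = 0 ->
    {in rs, forall r, 0 <= w.[r]} ->
  0 <= (x *m horner_mx A w *m x^T) 0 0.
Proof.
move=> urs A0 w_ge0.
pose L r := \prod_(s <- rem r rs) ('X - s%:P).
have rootL r s : r \in rs -> s \in rs -> ((L r).[s] == 0) = (s != r).
  by move=> rrs srs; rewrite -rootE root_prod_XsubC mem_rem_uniq // inE srs andbT.
pose W := \sum_(r <- rs) (w.[r] / (L r).[r] ^+ 2) *: (L r ^+ 2).
have rootW : all (root (w - W)) rs.
  apply/allP => s srs; rewrite rootE hornerD hornerN subr_eq0 horner_sum.
  rewrite (big_rem s) //= big1_seq => [|r /andP[_]]; last first.
    rewrite mem_rem_uniq // inE => /andP[rs_neq rrs].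
    apply/eqP; rewrite hornerZ horner_exp mulf_eq0 expf_eq0 /= rootL //.
    by rewrite [s == r]eq_sym rs_neq orbT.
  by rewrite addr0 hornerZ horner_exp divfK // expf_neq0 // rootL // eqxx.
have [u wE] := uniq_roots_prod_XsubC rootW (etrans (uniq_rootsE _) urs).
have -> : horner_mx A w = horner_mx A W.
  by apply/eqP; rewrite -subr_eq0 -rmorphB wE rmorphM /= A0 mulr0.
rewrite /W rmorph_sum mulmx_sumr mulmx_suml summxE big_seq sumr_ge0 // => r rrs.
rewrite /= linearZ /= -scalemxAr -scalemxAl mxE mulr_ge0 //.
  by rewrite divr_ge0 ?w_ge0 ?sqr_ge0.
have := quadratic_form_sum (x *m horner_mx A (L r)).
by rewrite trmx_mul trmx_horner_mx rmorphXn /= expr2 -mulmxE !mulmxA.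
Qed.

End Interpolation.

(** * Gaussian binomials *)

Fixpoint qbin (R : nzRingType) (Q : R) (n k : nat) : R :=
  match n, k with
  | _, 0 => 1
  | 0, _.+1 => 0
  | n'.+1, k'.+1 => Q ^+ k * qbin Q n' k + qbin Q n' k'
  end.

Section QBinomial.

Variables (R : realFieldType) (Q : R).

Lemma qbin0 n : qbin Q n 0 = 1. Proof. by case: n. Qed.

Lemma qbinS n k : qbin Q n.+1 k.+1 = Q ^+ k.+1 * qbin Q n k.+1 + qbin Q n k.
Proof. by []. Qed.

Lemma qbin_small n k : (n < k)%N -> qbin Q n k = 0.
Proof.
elim: n k => [|n IH] [|k] //= ltnk.
by rewrite !IH ?mulr0 ?addr0 //; lia.
Qed.

Lemma qbinn n : qbin Q n n = 1.
Proof. by elim: n => // n IH; rewrite qbinS IH qbin_small // mulr0 add0r. Qed.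

Lemma qbin_absorb n k :
  Q ^+ k * (Q ^+ k.+1 - 1) * qbin Q n k.+1 = (Q ^+ n - Q ^+ k) * qbin Q n k.
Proof.
elim: n k => [|n IH] [|k].
- by rewrite /= subrr mulr0 mul0r.
- by rewrite /= !mulr0.
- rewrite qbinS !qbin0; have := IH 0%N; rewrite qbin0.
  rewrite !expr0 expr1 exprS => E; have := congr1 ( *%R Q) E; lra.
have := IH k; have := IH k.+1.
rewrite !qbinS !exprS => E1 E2.
set a := qbin Q n k.+2 in E1 *; set b := qbin Q n k.+1 in E1 E2 *.
set c := qbin Q n k in E2 *; set z := Q ^+ k in E1 E2 *.
set y := Q ^+ n in E1 E2 *.
have -> : (Q * y - Q * z) * (Q * z * b + c) = (Q * y - Q * z) * (Q * z * b)
   + Q * (z * (Q * z - 1) * b) by rewrite E2; ring.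
have -> : Q * z * (Q * (Q * z) - 1) * (Q * (Q * z) * a + b)
  = Q * (Q * z) * (Q * z * (Q * (Q * z) - 1) * a)
    + Q * z * (Q * (Q * z) - 1) * b by ring.
rewrite E1; ring.
Qed.

Lemma qbin_absorbS n k :
  (Q ^+ k.+1 - 1) * qbin Q n.+1 k.+1 = (Q ^+ n.+1 - 1) * qbin Q n k.
Proof.
rewrite qbinS; have := qbin_absorb n k; rewrite !exprS => E.
transitivity (Q * (Q ^+ k * (Q * Q ^+ k - 1) * qbin Q n k.+1)
  + (Q * Q ^+ k - 1) * qbin Q n k); first ring.
by rewrite E; ring.
Qed.

(** Moebius inversion in the lattice of subspaces.  The rule of Pascal makes the sum
    telescope. *)
Lemma sum_sign_qbin n N : (n <= N)%N ->
  \sum_(k < N.+1) (-1) ^+ k * Q ^+ 'C(k, 2) * qbin Q n k = (n == 0%N)%:R.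
Proof.
move=> lenN; case: n lenN => [|n] lenN.
  rewrite big_ord_recl big1 => [|i _]; last by rewrite /= mulr0.
  by rewrite /= bin_small // !expr0 !mulr1 addr0.
rewrite big_ord_recl [X in X + _](_ : _ = 1); last first.
  by rewrite qbin0 bin_small // !expr0 !mulr1.
under eq_bigr => k _ do rewrite lift0 qbinS binS bin1 mulrDr.
rewrite big_split /=.
pose T k : R := (-1) ^+ k * Q ^+ ('C(k, 2) + k) * qbin Q n k.
have -> : \sum_(k < N) (-1) ^+ k.+1 * Q ^+ ('C(k, 2) + k) * qbin Q n k
  = - \sum_(k < N) T k.
  by rewrite -sumrN; apply: eq_bigr => k _; rewrite /T exprS; ring.
have -> : \sum_(k < N) (-1) ^+ k.+1 * Q ^+ ('C(k, 2) + k)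
     * (Q ^+ k.+1 * qbin Q n k.+1) = \sum_(k < N) T k.+1.
  by apply: eq_bigr => k _; rewrite /T binS bin1 !exprD; ring.
have -> : \sum_(k < N) T k.+1 = \sum_(k < N) T k - T 0%N.
  have E1 : \sum_(k < N.+1) T k = T 0%N + \sum_(k < N) T k.+1.
    by rewrite big_ord_recl; congr (_ + _); apply: eq_bigr => k _; rewrite lift0.
  have E2 : \sum_(k < N.+1) T k = \sum_(k < N) T k by
    rewrite big_ord_recr /= {2}/T qbin_small // mulr0 addr0.
  by rewrite -E2 E1 addrC addKr.
by rewrite /T qbin0 bin0n !expr0; ring.
Qed.

Hypothesis Q_gt1 : 1 < Q.

Lemma Qexp_neq0 k : Q ^+ k != 0.
Proof. by rewrite expf_neq0 // lt0r_neq0 // (lt_trans ltr01). Qed.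

Lemma Qexp_sub1 k : Q ^+ k.+1 - 1 != 0.
Proof. by rewrite subr_eq0 gt_eqF // exprn_egt1. Qed.

Lemma qbin_absorb_sub n k : (k <= n)%N ->
  (Q ^+ k.+1 - 1) * qbin Q n k.+1 = (Q ^+ (n - k) - 1) * qbin Q n k.
Proof.
move=> lekn; apply: (mulfI (Qexp_neq0 k)); rewrite !mulrA qbin_absorb.
by rewrite -{1}(subnKC lekn) exprD; congr (_ * _); ring.
Qed.

Lemma qbinS_dual n k : (k <= n)%N ->
  qbin Q n.+1 k.+1 = qbin Q n k.+1 + Q ^+ (n - k) * qbin Q n k.
Proof.
move=> lekn; have := qbin_absorb_sub lekn; rewrite qbinS => E.
rewrite -[LHS](subrK (qbin Q n k.+1)).
have -> : Q ^+ k.+1 * qbin Q n k.+1 + qbin Q n k - qbin Q n k.+1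
  = (Q ^+ k.+1 - 1) * qbin Q n k.+1 + qbin Q n k by ring.
by rewrite E; ring.
Qed.

(** For nonzero [b] this is [b ^+ n] times the q-Pochhammer symbol of [- a / b]. *)
Definition qpoch (a b : R) n := \prod_(u < n) (a * Q ^+ u + b).

(** The q-Vandermonde identity with one parameter equal to zero.  With the dual
    rule of Pascal, passing from [n] to [n + 1] multiplies every term, hence the
    sum, by [a * Q ^+ n]. *)
Lemma qvandermonde (a b : R) n :
  \sum_(e < n.+1) qbin Q n e * (- b) ^+ (n - e) * Q ^+ 'C(n - e, 2) * qpoch a b e
  = a ^+ n * Q ^+ 'C(n, 2).
Proof.
elim: n => [|n IH].
  by rewrite big_ord_recl big_ord0 /qpoch big_ord0 /= !expr0; ring.
rewrite big_ord_recl.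
under eq_bigr => e _ do rewrite lift0 subSS qbinS_dual -1?ltnS // -!mulrA mulrDl.
rewrite big_split /= addrA.
pose T e := qbin Q n e * (- b) ^+ (n.+1 - e) * Q ^+ 'C(n.+1 - e, 2) * qpoch a b e.
have -> : qbin Q n.+1 0 * (- b) ^+ n.+1 * Q ^+ 'C(n.+1, 2) * qpoch a b 0
  + \sum_(e < n.+1) qbin Q n e.+1 * ((- b) ^+ (n - e) * (Q ^+ 'C(n - e, 2) * qpoch a b e.+1))
  = \sum_(e < n.+1) T e.
  have E2 : \sum_(e < n.+2) T e = \sum_(e < n.+1) T e.
    by rewrite big_ord_recr /= {2}/T qbin_small // !mul0r addr0.
  rewrite -E2 [in RHS]big_ord_recl /T !qbin0 subn0; congr (_ + _).
  by apply: eq_bigr => e _; rewrite lift0 subSS -!mulrA.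
rewrite -big_split /=.
transitivity (\sum_(e < n.+1) (a * Q ^+ n) *
  (qbin Q n e * (- b) ^+ (n - e) * Q ^+ 'C(n - e, 2) * qpoch a b e)).
  apply: eq_bigr => e _; have le_en : (e <= n)%N by rewrite -ltnS.
  rewrite /T /qpoch big_ord_recr /= subSn // binS bin1 !exprS exprD.
  have -> : Q ^+ n = Q ^+ (n - e) * Q ^+ e by rewrite -exprD subnK.
  ring.
by rewrite -mulr_sumr IH binS bin1 exprD exprS; ring.
Qed.

End QBinomial.

(** * Eigenvalues of the dual polar graph *)

Lemma bin2_add m n : 'C(m + n, 2) = ('C(m, 2) + 'C(n, 2) + m * n)%N.
Proof.
elim: m => [|m IH]; first by rewrite add0n (@bin_small 0 2) //; lia.
by rewrite addSn !binS !bin1 IH; lia.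
Qed.

Section Eigenvalues.

Variables (q : rat) (d : nat).
Hypothesis q_gt1 : 1 < q.
Local Notation Q := (q ^+ 2).

Lemma Q_gt1 : 1 < Q. Proof. exact: exprn_egt1. Qed.

Lemma Q_sub1 : Q - 1 != 0. Proof. by rewrite subr_eq0 gt_eqF // Q_gt1. Qed.

Definition dual_polar_eigenvalue j : rat := q * qnum Q (d - j) - qnum Q j.
Local Notation theta := dual_polar_eigenvalue.

Lemma neighbour_op_const c m : (m <= d)%N ->
  neighbour_op q d (fun=> c) m = theta 0 * c.
Proof.
move=> le_md; rewrite /neighbour_op /theta /qnum subn0 expr0 subrr mul0r subr0.
rewrite -[in RHS](subnK le_md) exprD; field; exact: Q_sub1.
Qed.

(** Since [qbin Q m i] counts the [i]-subspaces common to two generators, this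
    bidiagonal form links consecutive inclusion matrices.  Its diagonal is the
    spectrum of the graph. *)
Lemma neighbour_op_qbin i m : (i < d)%N -> (m <= d)%N ->
  neighbour_op q d (fun m => qbin Q m i.+1) m
  = theta i.+1 * qbin Q m i.+1 + qnum Q (d - i) * qbin Q m i.
Proof.
move=> lt_id le_md; rewrite /neighbour_op /theta.
have Qn0 k := Qexp_neq0 Q_gt1 k; have Q1 := Q_sub1.
have Qi1 := Qexp_sub1 Q_gt1 i; rewrite exprS in Qi1.
set z := Q ^+ i in Qi1; have z0 : z != 0 := Qn0 i.
have E : qbin Q m i.+1 = (Q ^+ m - z) * qbin Q m i / (z * (Q * z - 1)).
  apply: (mulfI (mulf_neq0 z0 Qi1)).
  by rewrite -/z [RHS]mulrC divfK ?mulf_neq0 // /z -exprS qbin_absorb.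
(* The factor [qnum Q m] absorbs the case m = 0, where the predecessor is m. *)
have Eprev : qnum Q m * qbin Q m.-1 i.+1
    = (Q ^+ m / Q - z) * qbin Q m i.+1 / (z * (Q - 1)).
  case: m {le_md E} => [|m]; rewrite [_.-1]/=.
    by rewrite qbin_small // !(mulr0, mul0r).
  have := qbin_absorbS Q m i; have := qbin_absorb Q m i.
  rewrite -/z [Q ^+ i.+1]exprS -/z => E1 E2.
  have -> : Q ^+ m.+1 / Q = Q ^+ m by rewrite exprSr mulfK ?(Qn0 1%N).
  apply: (mulfI (mulf_neq0 z0 Qi1)).
  transitivity (qnum Q m.+1 * (z * (Q * z - 1) * qbin Q m i.+1)); first ring.
  rewrite E1 /qnum.
  transitivity ((Q ^+ m - z) / (Q - 1) * ((Q ^+ m.+1 - 1) * qbin Q m i)).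
    by field.
  by rewrite -E2; field; rewrite Q1 z0.
have -> : q * Q ^+ (d - m) * qnum Q m * qbin Q m.-1 i.+1
   = q * Q ^+ (d - m) * (qnum Q m * qbin Q m.-1 i.+1) by ring.
rewrite Eprev qbinS E /qnum [Q ^+ i.+1]exprS -/z.
have -> : Q ^+ (d - i.+1) = Q ^+ (d - m) * Q ^+ m / (Q * z).
  by rewrite /z -exprS -exprD subnK // -[in RHS](subnK lt_id) exprD mulfK.
have -> : Q ^+ (d - i) = Q ^+ (d - m) * Q ^+ m / z.
  by rewrite /z -exprD subnK // -[in RHS](subnK (ltnW lt_id)) exprD mulfK.
field; rewrite Q1 z0 Qi1 /=; have := Qn0 1%N; rewrite expr1 expf_eq0 /= => ->.
done.
Qed.

Definition qfact e := \prod_(u < e) qnum Q u.+1.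

Lemma qnum_gt0 k : 0 < qnum Q k.+1.
Proof. by rewrite divr_gt0 // subr_gt0 ?exprn_egt1 ?Q_gt1. Qed.

Lemma qfact_neq0 e : qfact e != 0.
Proof. by apply/prodf_neq0 => u _; rewrite gt_eqF // qnum_gt0. Qed.

(** By [neighbour_op_qbin] this product takes the graph to a multiple of the matrix
    that counts common subspaces of dimension [d - e]. *)
Definition last_roots_poly e : {poly rat} := \prod_(u < e) ('X - (theta (d - u))%:P).

Lemma theta_sub j e : (j + e <= d)%N ->
  theta j - theta (d - e) = qnum Q (d - j - e) * (q * Q ^+ e + Q ^+ j).
Proof.
move=> le_d; rewrite /theta /qnum subKn; last by lia.
have -> : (d - j = (d - j - e) + e)%N by lia.
have -> : (d - e = (d - j - e) + j)%N by lia.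
rewrite addnK !exprD; field; exact: Q_sub1.
Qed.

Lemma last_roots_poly_eval j e : (j <= d)%N -> (e <= d)%N ->
  (last_roots_poly e).[theta j] = qfact e * qbin Q (d - j) e * qpoch Q q (Q ^+ j) e.
Proof.
move=> le_jd; elim: e => [|e IH] le_ed.
  by rewrite /last_roots_poly /qfact /qpoch !big_ord0 qbin0 hornerC !mulr1.
rewrite /last_roots_poly big_ord_recr /= hornerM -/(last_roots_poly e) IH 1?ltnW //.
rewrite hornerXsubC.
have [le_e|gt_e] := leqP e (d - j); last first.
  by rewrite !qbin_small ?ltnS ?(ltnW gt_e) // !(mulr0, mul0r).
rewrite theta_sub; last by lia.
rewrite /qfact /qpoch !big_ord_recr /= -/(qfact e).
have -> : qfact e * qnum Q e.+1 * qbin Q (d - j) e.+1 =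
    qfact e * (qnum Q (d - j - e) * qbin Q (d - j) e).
  rewrite -mulrA; congr (_ * _); rewrite /qnum mulrAC qbin_absorb_sub ?Q_gt1 //.
  by rewrite mulrAC.
ring.
Qed.

(** The coefficients are those of the Moebius inversion [sum_sign_qbin] with the
    summation reversed, so that the value at the graph is the matrix of the
    relation of meeting trivially. *)
Definition opposite_poly : {poly rat} :=
  \sum_(e < d.+1) ((-1) ^+ (d - e) * Q ^+ 'C(d - e, 2) / qfact e) *: last_roots_poly e.

Definition opposite_eigenvalue j : rat :=
  (-1) ^+ j * Q ^+ 'C(j, 2) * (q ^+ (d - j) * Q ^+ 'C(d - j, 2)).

(** At [theta j] only the terms with [e <= d - j] survive, and they form the sum of
    [qvandermonde] for [a = q], [b = Q ^+ j] and [n = d - j]. *)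
Lemma opposite_poly_eval j : (j <= d)%N ->
  opposite_poly.[theta j] = opposite_eigenvalue j.
Proof.
move=> le_jd; rewrite horner_sum /opposite_eigenvalue.
rewrite -(qvandermonde Q_gt1 q (Q ^+ j)) mulr_sumr.
rewrite (big_ord_widen d.+1 (fun e => (-1) ^+ j * Q ^+ 'C(j, 2) *
  (qbin Q (d - j) e * (- Q ^+ j) ^+ (d - j - e) * Q ^+ 'C(d - j - e, 2)
     * qpoch Q q (Q ^+ j) e))); last by lia.
rewrite [RHS]big_mkcond; apply: eq_bigr => e _.
rewrite hornerZ last_roots_poly_eval // -1?ltnS //; case: ifPn; rewrite ltnS => le_e.
  have -> : (d - e = j + (d - j - e))%N by lia.
  rewrite bin2_add !exprD exprM [(- Q ^+ j) ^+ _]exprNn.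
  field; exact: qfact_neq0.
by rewrite qbin_small ?mulr0 ?mul0r ?mulr0 // ltnNge.
Qed.

End Eigenvalues.

(** * The weights *)

Section Weights.

Variables (q : rat) (d : nat).
Hypothesis q_ge2 : 2 <= q.
Hypothesis d_gt1 : (1 < d)%N.
Local Notation Q := (q ^+ 2).
Local Notation theta := (dual_polar_eigenvalue q d).

Let q_gt1 : 1 < q. Proof. exact: lt_le_trans q_ge2. Qed.

(** Multiplication by the graph leads from the relation of meeting in dimension 0 to
    dimension 1 and then to dimension 2.  Solving these two recurrences for the
    last relation gives it, up to a positive factor, as this polynomial times the
    relation of meeting trivially. *)
Definition dim2_ratio_poly : {poly rat} :=
  ('X - ((q - 1) * qnum Q d.-1)%:P) * ('X - ((q - 1) * qnum Q d)%:P)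
  - (q * Q ^+ d.-1 * qnum Q d)%:P.

Local Notation ratio j := (dim2_ratio_poly.[theta j]).

Lemma Qd_pred : Q ^+ d = Q * Q ^+ d.-1.
Proof. by rewrite -exprS prednK // ltnW. Qed.

Lemma dim2_ratio_eval j (P := Q ^+ d.-1) (y := q * Q ^+ (d - j) - Q ^+ j) :
  (j <= d)%N -> (Q - 1) ^+ 2 * ratio j =
  (y - (q - 1) * (Q * P)) * (y - (q - 1) * P) - q * (Q - 1) * P * (Q * P - 1).
Proof.
move=> le_jd; rewrite !hornerE /= /dual_polar_eigenvalue /qnum Qd_pred /y -/P.
by field; exact: Q_sub1.
Qed.

Lemma dim2_ratio_evald (P := Q ^+ d.-1) :
  (Q - 1) ^+ 2 * ratio d = Q * (Q * P - 1) * (P - 1).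
Proof. by rewrite dim2_ratio_eval // subnn expr0 Qd_pred -/P; ring. Qed.

Lemma sqr_Q_sub1_gt0 : 0 < (Q - 1) ^+ 2.
Proof. by rewrite exprn_gt0 // subr_gt0 Q_gt1. Qed.

Lemma dim2_ratiod_gt0 : 0 < ratio d.
Proof.
rewrite -(pmulr_rgt0 _ sqr_Q_sub1_gt0) dim2_ratio_evald -Qd_pred.
have d1 : (0 < d.-1)%N by lia.
have Q1 := Q_gt1 q_gt1.
have P1 : 1 < Q ^+ d.-1 by rewrite exprn_egt1 // -lt0n.
have Qd1 : 1 < Q ^+ d by rewrite exprn_egt1 // -lt0n; lia.
by rewrite !mulr_gt0 ?subr_gt0 // (lt_trans ltr01).
Qed.

Lemma exp_mid j : (0 < j < d)%N ->
  [/\ Q <= Q ^+ j, Q <= Q ^+ (d - j), Q ^+ j <= Q ^+ d.-1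
    & Q ^+ (d - j) <= Q ^+ d.-1].
Proof.
move=> /andP[j0 jd]; have Q1 := Q_gt1 q_gt1.
rewrite -{1 3}[Q]expr1 !ler_eXn2l //; split; lia.
Qed.

(** By [dim2_ratio_eval] the value at [theta j] is a quadratic polynomial in
    [y = q * Q ^+ (d - j) - Q ^+ j].  It decreases for [y] up to the value at
    [j = 1], which is the largest one in question. *)
Lemma dim2_ratio_mono j : (0 < j < d)%N -> ratio 1 <= ratio j.
Proof.
move=> jd; rewrite -(ler_pM2l sqr_Q_sub1_gt0) !dim2_ratio_eval; try lia.
have [b1 a1 b2 a2] := exp_mid jd; rewrite subn1 expr1.
set P := Q ^+ d.-1 in b2 a2 *; set a := Q ^+ (d - j) in a1 a2 *.
set b := Q ^+ j in b1 b2 *.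
rewrite -subr_ge0.
have -> : (q * a - b - (q - 1) * (Q * P)) * (q * a - b - (q - 1) * P) -
    q * (Q - 1) * P * (Q * P - 1) -
    ((q * P - Q - (q - 1) * (Q * P)) * (q * P - Q - (q - 1) * P) -
      q * (Q - 1) * P * (Q * P - 1))
  = (q * (P - a) + (b - Q)) * ((q - 1) * (Q + 1) * P - (q * (P + a) - Q - b)).
  ring.
have q2 := q_ge2; have q0 : 0 <= q by lra.
have Q0 : 0 <= Q by rewrite exprn_ge0.
apply: mulr_ge0.
  by rewrite addr_ge0 ?mulr_ge0 // subr_ge0.
have le1 : q * (P + a) <= 2 * q * P.
  by have := ler_wpM2l q0 a2; lra.
have le2 : 2 * q <= (q - 1) * (Q + 1).
  have : 0 <= (q - 2) * (q * q + q + 1) by rewrite mulr_ge0 //; nra.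
  rewrite expr2; lra.
have : 2 * q * P <= (q - 1) * (Q + 1) * P by rewrite ler_wpM2r //; lra.
lra.
Qed.

(** Here [y] lies between [- P] and [q * P] for [P = Q ^+ (d - 1)], so the term
    [y ^+ 2] is dominated by the negative term linear in [y + Q * P]. *)
Lemma dim2_ratio_le0 j : (0 < j < d)%N -> ratio j <= 0.
Proof.
move=> jd; rewrite -(pmulr_rle0 _ sqr_Q_sub1_gt0) dim2_ratio_eval; last by lia.
have [b1 a1 b2 a2] := exp_mid jd.
set P := Q ^+ d.-1 in b2 a2 *; set a := Q ^+ (d - j) in a1 a2 *.
set b := Q ^+ j in b1 b2 *; set y := q * a - b.
have q2 := q_ge2; have q0 : 0 <= q by lra.
have Q4 : 2 * q <= Q by rewrite expr2 ler_wpM2r.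
have qa0 : 0 <= q * a by rewrite mulr_ge0 //; lra.
have y_ge : - P <= y by rewrite /y; lra.
have y_le : y <= q * P by rewrite /y; have := ler_wpM2l q0 a2; lra.
have y2 : y ^+ 2 <= Q * P ^+ 2.
  have P2 : 0 <= P by lra.
  have : 0 <= (q * P - y) * (q * P + y).
    have : P <= q * P by rewrite ler_peMl //; lra.
    by move=> ?; rewrite mulr_ge0 //; lra.
  rewrite [Q]expr2; lra.
have lin : (Q + 1) * P * ((Q - 1) * P) <= (q - 1) * (Q + 1) * P * (y + Q * P).
  apply: ler_pM; try lra; try nra.
have P2 : Q <= P by lra.
have small : (Q - 1) * q * P <= (Q ^+ 2 - Q - 1) * P * P.
  rewrite ler_wpM2r //; first by lra.
  have le_Q2 : 2 * Q <= Q ^+ 2 by rewrite [Q ^+ 2]expr2 ler_wpM2r //; lra.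
  by apply: ler_pM; lra.
lra.
Qed.

Lemma opposite_eigenvalueE j :
  opposite_eigenvalue q d j = (-1) ^+ j * q ^+ (j * j.-1 + (d - j) ^ 2)%N.
Proof.
have C2 k : (2 * 'C(k, 2) = k * k.-1)%N.
  by elim: k => // k IH; rewrite binS bin1 mulnDr IH; case: k {IH} => //= k; lia.
rewrite /opposite_eigenvalue -!exprM !C2 -mulrA -!exprD; congr (_ * _ ^+ _).
by case: (d - j)%N => // k /=; lia.
Qed.

(** At the graph this is a positive multiple of the relation of meeting trivially
    minus a positive multiple of the relation of meeting in dimension 2.  For odd
    [d] the coefficients make the values at [theta 1] and [theta d] both equal to
    [- ekr_min]. *)
Definition ekr_poly : {poly rat} :=
  opposite_poly q d * ((q ^+ d.-1 * ratio d - ratio 1)%:P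
                       - (q ^+ d.-1 - 1) *: dim2_ratio_poly).

Definition ekr_min : rat := q ^+ (d * d.-1)%N * (ratio d - ratio 1).

Lemma ekr_poly_eval j : (j <= d)%N -> ekr_poly.[theta j] =
  opposite_eigenvalue q d j
  * (q ^+ d.-1 * ratio d - ratio 1 - (q ^+ d.-1 - 1) * ratio j).
Proof.
by move=> le_jd; rewrite hornerM opposite_poly_eval // hornerD hornerN hornerZ hornerC.
Qed.

Lemma ekr_min_gt0 : 0 < ekr_min.
Proof.
have q0 : 0 < q by rewrite (lt_trans ltr01).
rewrite mulr_gt0 ?exprn_gt0 // subr_gt0 (le_lt_trans _ dim2_ratiod_gt0) //.
exact: dim2_ratio_le0.
Qed.

(** The second factor in [ekr_poly_eval] is nonnegative, so for even [j] the value
    is nonnegative.  For odd [j < d] both factors are at most as large in absolute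
    value as they are at [j = 1]. *)
Lemma ekr_poly_ge j : odd d -> (0 < j <= d)%N -> - ekr_min <= ekr_poly.[theta j].
Proof.
move=> d_odd /andP[j0 le_jd]; rewrite ekr_poly_eval // opposite_eigenvalueE.
have N0 := ekr_min_gt0.
have gd := dim2_ratiod_gt0; set s := q ^+ d.-1.
have [->|ne_jd] := eqVneq j d.
  rewrite subnn exp0n // addn0 -signr_odd d_odd expr1 mulN1r mulNr lerN2.
  by rewrite /ekr_min le_eqVlt; apply/orP; left; apply/eqP; ring.
have jd : (0 < j < d)%N by rewrite j0 ltn_neqAle ne_jd.
have g1 := dim2_ratio_mono jd; have gj := dim2_ratio_le0 jd.
have s1 : 1 <= s by rewrite exprn_ege1 // ltW.
have b0 : 0 <= s * ratio d - ratio 1 - (s - 1) * ratio j.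
  have : 0 <= s * ratio d by rewrite mulr_ge0 //; lra.
  have : 0 <= (s - 1) * - ratio j by rewrite mulr_ge0 //; lra.
  lra.
have b1 : s * ratio d - ratio 1 - (s - 1) * ratio j <= s * (ratio d - ratio 1).
  have : 0 <= (s - 1) * (ratio j - ratio 1) by rewrite mulr_ge0 //; lra.
  lra.
have q0 : 0 <= q by rewrite ltW // (lt_trans ltr01).
set b := (_ - _ : rat) in b0 b1 *.
rewrite -signr_odd; case: (odd j).
  rewrite expr1 mulN1r mulNr lerN2 /ekr_min.
  apply: le_trans (_ : q ^+ (d.-1 ^ 2) * (s * (ratio d - ratio 1)) <= _).
    apply: ler_pM; rewrite ?exprn_ge0 // ler_weXn2l //; first exact: ltW.
    have [k [kE dE]] : exists k, j = k.+1 /\ (k.+2 <= d)%N.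
      by exists j.-1; lia.
    rewrite kE /=; nia.
  rewrite mulrA -exprD le_eqVlt; apply/orP; left; apply/eqP.
  by congr (_ ^+ _ * _); rewrite -(prednK (ltnW d_gt1)) /=; nia.
rewrite expr0 mul1r; apply: le_trans (_ : 0 <= _); first by rewrite oppr_le0 ltW.
by rewrite mulr_ge0 // exprn_ge0.
Qed.

(** After division by [q ^+ (d * (d - 1))] this is a polynomial identity in [q] and
    [w = q ^+ (d - 2)]. *)
Lemma ekr_balance :
  ekr_min * ((q ^+ (2 * d - 1) + 1) * (q ^+ (d - 2) + 1) * (q ^+ d + 1))
  = (ekr_poly.[theta 0] + ekr_min) * ((q ^+ 2 + q + 1) * q ^+ (2 * d - 3) + 1).
Proof.
apply: (mulfI (lt0r_neq0 sqr_Q_sub1_gt0)).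
rewrite /ekr_min ekr_poly_eval // opposite_eigenvalueE.
set V := q ^+ (d * d.-1)%N.
set w := q ^+ (d - 2).
have PE : Q ^+ d.-1 = q ^+ 2 * w ^+ 2.
  by rewrite /w -!exprM -exprD; congr (_ ^+ _); lia.
have -> : q ^+ (0 * 0.-1 + (d - 0) ^ 2) = V * (q ^+ 2 * w).
  rewrite /V /w -!exprD; congr (_ ^+ _).
  by rewrite -{1 2 3}(subnK d_gt1) addn2 /=; nia.
have sE : q ^+ d.-1 = q * w by rewrite /w -exprS; congr (_ ^+ _); lia.
have -> : q ^+ (2 * d - 1) = q ^+ 3 * w ^+ 2.
  by rewrite /w -!exprM -exprD; congr (_ ^+ _); lia.
have -> : q ^+ (2 * d - 3) = q * w ^+ 2.
  by rewrite /w -!exprM -exprS; congr (_ ^+ _); lia.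
have -> : q ^+ d = q ^+ 2 * w by rewrite /w -exprD; congr (_ ^+ _); lia.
rewrite sE expr0 mul1r.
transitivity (V * ((Q - 1) ^+ 2 * ratio d - (Q - 1) ^+ 2 * ratio 1)
   * ((q ^+ 3 * w ^+ 2 + 1) * (w + 1) * (q ^+ 2 * w + 1))); first ring.
transitivity (V * ((q ^+ 2 * w) * (q * w * ((Q - 1) ^+ 2 * ratio d)
    - (Q - 1) ^+ 2 * ratio 1 - (q * w - 1) * ((Q - 1) ^+ 2 * ratio 0))
  + ((Q - 1) ^+ 2 * ratio d - (Q - 1) ^+ 2 * ratio 1))
   * ((Q + q + 1) * (q * w ^+ 2) + 1)); last ring.
rewrite dim2_ratio_evald !dim2_ratio_eval //; last by lia.
rewrite subn0 Qd_pred subn1 PE; ring.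
Qed.

Lemma ekr_poly_top_gt0 : 0 < ekr_poly.[theta 0] + ekr_min.
Proof.
have q0 : 0 < q by rewrite (lt_trans ltr01).
have B_gt0 : 0 < (q ^+ 2 + q + 1) * q ^+ (2 * d - 3) + 1.
  by rewrite addr_gt0 // mulr_gt0 ?exprn_gt0 // !addr_gt0 // exprn_gt0.
rewrite -(pmulr_lgt0 _ B_gt0) -ekr_balance mulr_gt0 ?ekr_min_gt0 //.
by rewrite !mulr_gt0 // addr_gt0 // exprn_gt0.
Qed.

End Weights.

(** * The weighted Hoffman bound *)

Section WeightedHoffman.

Variables (R : realFieldType) (n : nat) (A : 'M[R]_n.+1).

Definition set_row (S : {set 'I_n.+1}) : 'rV[R]_n.+1 := \row_i (i \in S)%:R.

Lemma set_row_form (S : {set 'I_n.+1}) (B : 'M[R]_n.+1) :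
  (set_row S *m B *m (set_row S)^T) 0 0 = \sum_(i in S) \sum_(j in S) B i j.
Proof.
rewrite exchange_big mxE [RHS]big_mkcond; apply: eq_bigr => j _.
rewrite !mxE; case: (j \in S); rewrite ?mulr0 // mulr1.
rewrite [RHS]big_mkcond; apply: eq_bigr => i _.
by rewrite mxE; case: (i \in S); rewrite ?mul0r ?mul1r.
Qed.

(** Shifting [p] by [N] makes it nonnegative on the spectrum, and the multiple [c] of
    the all-ones matrix that brings the value at [r0] down to zero can then be
    subtracted.  The quadratic form of the result at the indicator vector of [S] is
    nonnegative, while the weights contribute at most zero. *)
Lemma weighted_hoffman (rs : seq R) (r0 : R) (p pJ : {poly R}) (N v : R)
    (S : {set 'I_n.+1}) :
    A^T = A -> uniq rs -> horner_mx A (\prod_(r <- rs) ('X - r%:P)) = 0 ->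
    horner_mx A pJ = const_mx 1 -> 0 < v -> pJ.[r0] = v ->
    {in rs, forall r, r != r0 -> pJ.[r] = 0} ->
    0 <= N -> {in rs, forall r, - N <= p.[r]} ->
    {in S &, forall i j, horner_mx A p i j <= 0} ->
  #|S|%:R * (p.[r0] + N) <= N * v.
Proof.
move=> symA urs A0 pJA v_gt0 pJr0 pJr N_ge0 leNp pS.
pose c := (p.[r0] + N) / v.
have w_ge0 : {in rs, forall r, 0 <= (p + N%:P - c *: pJ).[r]}.
  move=> r rrs; rewrite !hornerE /=; have [->|rr0] := eqVneq r r0.
    by rewrite pJr0 divfK ?gt_eqF // subrr.
  by rewrite pJr // mulr0 subr0; have := leNp r rrs; lra.
have := horner_mx_psd symA (set_row S) urs A0 w_ge0.
rewrite set_row_form => le0.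
have E : \sum_(i in S) \sum_(j in S) (horner_mx A (p + N%:P - c *: pJ)) i j
  = \sum_(i in S) \sum_(j in S) horner_mx A p i j
    + #|S|%:R * N - #|S|%:R * #|S|%:R * c.
  transitivity (\sum_(i in S)
      ((\sum_(j in S) horner_mx A p i j) + N - #|S|%:R * c)); last first.
    by rewrite sumrB big_split /= !sumr_const -mulrA !mulr_natl.
  apply: eq_bigr => i iS.
  transitivity (\sum_(j in S) (horner_mx A p i j + (i == j)%:R * N - c)).
    apply: eq_bigr => j jS.
    rewrite rmorphB rmorphD /= horner_mx_C linearZ /= pJA !mxE mulr1.
    by rewrite mulr_natl.
  rewrite sumrB big_split /= sumr_const mulr_natl; congr (_ + _ - _).
  rewrite (bigD1 i) //= eqxx mul1r big1 ?addr0 // => j /andP[_ ji].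
  by rewrite eq_sym (negPf ji) mul0r.
have le_p : \sum_(i in S) \sum_(j in S) horner_mx A p i j <= 0.
  by apply: sumr_le0 => i iS; apply: sumr_le0 => j jS; apply: pS.
have [S0|S0] := posnP #|S|; first by rewrite S0 mul0r mulr_ge0 // ltW.
have s_gt0 : 0 < #|S|%:R :> R by rewrite ltr0n.
have : #|S|%:R * (#|S|%:R * c) <= #|S|%:R * N.
  by rewrite mulrA; move: le0; rewrite E; lra.
rewrite ler_pM2l // /c mulrA ler_pdivrMr //.
Qed.

End WeightedHoffman.

(** * The algebra spanned by the relations *)

Section Scheme.

Variables (q : rat) (d n : nat) (delta : 'I_n.+1 -> 'I_n.+1 -> nat).
Hypothesis q_ge2 : 2 <= q.
Hypothesis d_gt1 : (1 < d)%N.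
Hypothesis deltaC : forall i j, delta i j = delta j i.
Hypothesis delta_le : forall i j, (delta i j <= d)%N.
Hypothesis delta_eq : forall i j, (delta i j == d) = (i == j).
Hypothesis delta_sum : forall i j (f : nat -> rat),
  \sum_(k | delta i k == d.-1) f (delta k j) = neighbour_op q d f (delta i j).

Local Notation Q := (q ^+ 2).
Local Notation theta := (dual_polar_eigenvalue q d).

Let q_gt1 : 1 < q. Proof. exact: lt_le_trans q_ge2. Qed.

Definition dim_mx (f : nat -> rat) : 'M[rat]_n.+1 := \matrix_(i, j) f (delta i j).
Definition graph_mx := dim_mx (fun m => (m == d.-1)%:R).

Lemma eq_dim_mx f g : (forall m, (m <= d)%N -> f m = g m) -> dim_mx f = dim_mx g.
Proof. by move=> fg; apply/matrixP => i j; rewrite !mxE fg. Qed.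

Lemma trmx_graph_mx : graph_mx^T = graph_mx.
Proof. by apply/matrixP => i j; rewrite !mxE deltaC. Qed.

Lemma mul_graph_mx f : graph_mx *m dim_mx f = dim_mx (neighbour_op q d f).
Proof.
apply/matrixP => i j; rewrite !mxE -delta_sum [RHS]big_mkcond.
by apply: eq_bigr => k _; rewrite !mxE; case: eqP; rewrite ?mul1r ?mul0r.
Qed.

Lemma dim_mxZ c f : dim_mx (fun m => c * f m) = c *: dim_mx f.
Proof. by apply/matrixP => i j; rewrite !mxE. Qed.

(** Descending induction from the identity matrix, which counts the common subspaces
    of dimension [d]. *)
Lemma horner_last_roots e : (e <= d)%N ->
  horner_mx graph_mx (last_roots_poly q d e) = qfact q e *: dim_mx (qbin Q ^~ (d - e)%N).
Proof.
elim: e => [|e IH] le_ed.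
  rewrite /last_roots_poly /qfact !big_ord0 rmorph1 scale1r subn0.
  apply/matrixP => i j; rewrite !mxE -delta_eq; case: ltngtP (delta_le i j) => //.
    by move=> lt _; rewrite qbin_small.
  by move=> -> _; rewrite qbinn.
rewrite /last_roots_poly /qfact !big_ord_recr /= -/(last_roots_poly q d e) -/(qfact q e).
rewrite mulrC rmorphM rmorphB /= horner_mx_X horner_mx_C IH 1?ltnW //.
rewrite -scalerAr -scalerA; congr (_ *: _).
rewrite mulrBl -mulmxE mul_graph_mx mul_scalar_mx.
have -> : (d - e = (d - e.+1).+1)%N by lia.
apply/matrixP => i j; rewrite !mxE neighbour_op_qbin ?delta_le //; last by lia.
have -> : (d - (d - e.+1) = e.+1)%N by lia.
ring.
Qed.

Lemma horner_all_ones :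
  horner_mx graph_mx ((qfact q d)^-1 *: last_roots_poly q d d) = const_mx 1.
Proof.
rewrite linearZ /= horner_last_roots // scalerA mulVf ?qfact_neq0 // scale1r subnn.
by apply/matrixP => i j; rewrite !mxE qbin0.
Qed.

Lemma horner_last_roots_full : horner_mx graph_mx (last_roots_poly q d d.+1) = 0.
Proof.
rewrite /last_roots_poly big_ord_recr /= -/(last_roots_poly q d d) subnn mulrC rmorphM.
rewrite rmorphB /= horner_mx_X horner_mx_C horner_last_roots // subnn.
rewrite -scalerAr mulrBl -mulmxE mul_graph_mx mul_scalar_mx -dim_mxZ.
rewrite (@eq_dim_mx _ (fun m => theta 0 * qbin Q m 0)) ?subrr ?scaler0 //.
by move=> m le_md; rewrite qbin0 -(neighbour_op_const q_gt1 1 le_md);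
   rewrite /neighbour_op !qbin0.
Qed.

Lemma horner_opposite :
  horner_mx graph_mx (opposite_poly q d) = dim_mx (fun m => (m == 0%N)%:R).
Proof.
rewrite /opposite_poly rmorph_sum /=.
apply/matrixP => i j; rewrite summxE mxE -(sum_sign_qbin Q (delta_le i j)).
rewrite [RHS](reindex_inj rev_ord_inj); apply: eq_bigr => e _ /=.
have le_ed : (e <= d)%N by rewrite -ltnS.
rewrite linearZ /= horner_last_roots // scalerA divfK ?qfact_neq0 // !mxE.
by rewrite subSS.
Qed.

Lemma qnum1 : qnum Q 1 = 1.
Proof. by rewrite /qnum expr1 divff // Q_sub1. Qed.

Lemma qnum0 : qnum Q 0 = 0. Proof. by rewrite /qnum expr0 subrr mul0r. Qed.

Lemma neighbour_op_0 m : (m <= d)%N ->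
  neighbour_op q d (fun m => (m == 0%N)%:R) m
  = (q - 1) * qnum Q d * (m == 0%N)%:R + q * Q ^+ d.-1 * (m == 1%N)%:R.
Proof.
rewrite /neighbour_op; case: m => [|[|m]] le_md /=.
- by rewrite qnum0 subn0; ring.
- by rewrite qnum1 subn1; ring.
by ring.
Qed.

Lemma neighbour_op_1 m : (m <= d)%N ->
  neighbour_op q d (fun m => (m == 1%N)%:R) m
  = qnum Q d * (m == 0%N)%:R + (q - 1) * qnum Q d.-1 * (m == 1%N)%:R
    + q * Q ^+ (d - 2) * qnum Q 2 * (m == 2)%:R.
Proof.
rewrite /neighbour_op; case: m => [|[|[|m]]] le_md /=.
- by rewrite qnum0 subn0; ring.
- by rewrite qnum1 subn1; ring.
- by ring.
by ring.
Qed.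

Lemma horner_dim2_ratio :
  horner_mx graph_mx (dim2_ratio_poly q d * opposite_poly q d)
  = dim_mx (fun m => q ^+ 2 * Q ^+ d.-1 * Q ^+ (d - 2) * qnum Q 2 * (m == 2)%:R).
Proof.
rewrite rmorphM rmorphB rmorphM !rmorphB /= horner_mx_X !horner_mx_C.
rewrite horner_opposite mulrBl -mulrA [X in _ * X]mulrBl -!mulmxE !mul_scalar_mx.
rewrite !mul_graph_mx.
have -> : dim_mx (neighbour_op q d (fun m => (m == 0%N)%:R))
   - ((q - 1) * qnum Q d) *: dim_mx (fun m => (m == 0%N)%:R)
  = (q * Q ^+ d.-1) *: dim_mx (fun m => (m == 1%N)%:R).
  by apply/matrixP => i j; rewrite !mxE neighbour_op_0 //; ring.
rewrite mulmxBl mul_scalar_mx -scalemxAr mul_graph_mx.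
by apply/matrixP => i j; rewrite !mxE neighbour_op_1 //; ring.
Qed.

Definition spectrum : seq rat := [seq theta (d - u) | u <- iota 0 d.+1].

Lemma mem_spectrum r : r \in spectrum -> exists2 j, (j <= d)%N & r = theta j.
Proof.
by case/mapP => u _ ->; exists (d - u)%N => //; apply: leq_subr.
Qed.

Lemma dual_polar_eigenvalue_inj i j : (i <= d)%N -> (j <= d)%N -> theta i = theta j -> i = j.
Proof.
wlog lt_ij : i j / (i < j)%N.
  move=> H le_i le_j eq_ij; case: (ltngtP i j) => // lt_ij; first exact: H.
  by apply/esym/H.
move=> le_i le_j /eqP; rewrite -subr_eq0 -(subKn le_j) theta_sub //; last by lia.
have [k ->] : exists k, (d - i - (d - j) = k.+1)%N by exists (j - i).-1; lia.
have q0 : 0 < q by rewrite (lt_trans ltr01).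
rewrite gt_eqF // mulr_gt0 ?qnum_gt0 // addr_gt0 // ?mulr_gt0 ?exprn_gt0 //.
Qed.

Lemma spectrum_uniq : uniq spectrum.
Proof.
rewrite map_inj_in_uniq ?iota_uniq // => u v; rewrite !mem_iota => u_d v_d E.
have := dual_polar_eigenvalue_inj (leq_subr u d) (leq_subr v d) E; lia.
Qed.

Lemma prod_spectrum : \prod_(r <- spectrum) ('X - r%:P) = last_roots_poly q d d.+1.
Proof.
by rewrite big_map /last_roots_poly -(big_mkord xpredT (fun u => 'X - (theta (d - u))%:P))
  /index_iota subn0.
Qed.

(** On pairs from [S] the relation of meeting trivially has no entry, and the
    relation of meeting in dimension 2 occurs with a negative coefficient. *)
Lemma scheme_ekr_bound (S : {set 'I_n.+1}) : odd d ->
    {in S &, forall i j, (0 < delta i j)%N} ->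
  #|S|%:R * ((ekr_poly q d).[theta 0] + ekr_min q d) <= ekr_min q d * qpoch Q q 1 d.
Proof.
move=> d_odd S_gt0.
have q0 : 0 < q by rewrite (lt_trans ltr01).
have N_gt0 := ekr_min_gt0 q_ge2 d_gt1.
apply: (weighted_hoffman (rs := spectrum) (pJ := (qfact q d)^-1 *: last_roots_poly q d d)
  trmx_graph_mx spectrum_uniq _ horner_all_ones) => //.
- by rewrite prod_spectrum horner_last_roots_full.
- by rewrite prodr_gt0 // => u _; rewrite addr_gt0 // mulr_gt0 // !exprn_gt0.
- rewrite hornerZ last_roots_poly_eval // subn0 qbinn mulr1 expr0 mulrA.
  by rewrite mulVf ?mul1r // qfact_neq0.
- move=> r /mem_spectrum[j le_jd ->] ne_j; rewrite hornerZ last_roots_poly_eval //.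
  rewrite qbin_small ?mulr0 ?mul0r ?mulr0 //.
  by case: j ne_j le_jd => [|j]; rewrite ?eqxx //; lia.
- exact: ltW.
- move=> r /mem_spectrum[[|j] le_jd ->]; last exact: ekr_poly_ge.
  by rewrite -subr_ge0 opprK ltW // ekr_poly_top_gt0.
move=> i j iS jS.
have -> : ekr_poly q d =
    (q ^+ d.-1 * (dim2_ratio_poly q d).[theta d] - (dim2_ratio_poly q d).[theta 1])
      *: opposite_poly q d
    - (q ^+ d.-1 - 1) *: (dim2_ratio_poly q d * opposite_poly q d).
  by rewrite /ekr_poly -!mul_polyC; ring.
rewrite rmorphB /= !linearZ /= horner_opposite horner_dim2_ratio !mxE.
rewrite [_ == 0%N]gtn_eqF ?S_gt0 // mulr0n mulr0 add0r mulrN oppr_le0.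
have s1 : 1 <= q ^+ d.-1 by rewrite exprn_ege1 // ltW.
move: (qnum _ 2) (ltW (qnum_gt0 q_gt1 1)) => c2 c2_ge0.
have Q_ge0 : 0 <= Q by rewrite exprn_ge0 // ltW.
by rewrite !mulr_ge0 ?subr_ge0 ?ler0n ?exprn_ge0 ?(ltW q0).
Qed.

End Scheme.

(** * The bound *)

Lemma prod_skip_middle (f : nat -> nat) d : odd d -> (1 < d)%N ->
  (\prod_(1 <= i < d) f i
   = f d./2 * f d./2.+1 *
     \prod_(1 <= i < d | (2 * i != d - 1) && (2 * i != d + 1)) f i)%N.
Proof.
move=> d_odd d_gt1; have dE : (d = d./2.*2.+1)%N by rewrite -[LHS]odd_double_half d_odd.
set k := d./2 in dE *.
pose P i := (2 * i != d - 1)%N && (2 * i != d + 1)%N.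
have split_prod R : (\prod_(1 <= i < d | R i) f i =
   \prod_(1 <= i < k | R i) f i * \prod_(k <= i < k.+2 | R i) f i
    * \prod_(k.+2 <= i < d | R i) f i)%N.
  by rewrite -mulnA -!big_cat_nat //; lia.
have keep a b : (b <= k)%N || (k.+2 <= a)%N ->
   (\prod_(a <= i < b | P i) f i = \prod_(a <= i < b) f i)%N.
  move=> ab; rewrite big_nat_cond [RHS]big_nat_cond; apply: eq_bigl => i.
  by rewrite /P andbT; apply/andP/idP => [[]//|ib]; split => //; lia.
rewrite (split_prod xpredT) (split_prod P) (keep 1%N k) ?leqnn //.
rewrite (keep k.+2 d) ?leqnn ?orbT //.
have -> : (\prod_(k <= i < k.+2 | P i) f i = 1)%N.
  rewrite big_nat_cond big_pred0 // => i; rewrite /P; lia.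
have -> : (\prod_(k <= i < k.+2) f i = f k * f k.+1)%N.
  by rewrite big_ltn // big_nat1.
nia.
Qed.

(** The left side is the number of all generators; the three factors split off
    are those for [i = d], [i = (d - 1) / 2] and [i = (d + 1) / 2]. *)
Lemma qpoch_product (q d : nat) : odd d -> (1 < d)%N ->
  qpoch (q%:R ^+ 2) q%:R 1 d =
  (q%:R ^+ (2 * d - 1) + 1) * (q%:R ^+ (d - 2) + 1) * (q%:R ^+ d + 1)
  * (\prod_(1 <= i < d | (2 * i != d - 1)%N && (2 * i != d + 1)%N)
       (q ^ (2 * i - 1) + 1)%N)%:R :> rat.
Proof.
move=> d_odd d_gt1; have dE : (d = d./2.*2.+1)%N by rewrite -[LHS]odd_double_half d_odd.
pose f i := (q ^ (2 * i - 1) + 1)%N.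
have fE i : (f i)%:R = q%:R ^+ (2 * i - 1) + 1 :> rat by rewrite natrD natrX.
have -> : qpoch (q%:R ^+ 2) q%:R 1 d = (\prod_(1 <= i < d.+1) f i)%N%:R :> rat.
  rewrite /qpoch natr_prod big_add1 /= big_mkord; apply: eq_bigr => u _.
  by rewrite fE -exprM -exprS; congr (_ ^+ _ + _); lia.
rewrite big_nat_recr /=; last by lia.
rewrite (prod_skip_middle f) // !natrM -/f !fE.
have -> : (2 * d./2 - 1 = d - 2)%N by lia.
have -> : (2 * d./2.+1 - 1 = d)%N by lia.
ring.
Qed.

Theorem theorem1p1 (q d : nat) (F : finFieldType) (theta : {rmorphism F -> F})
    (vT : vectType F) (form : {hermitian vT for false & theta})
    (S : {set {vspace vT}})
    (hq : prime_power q) (hd : (5 <= d)%N) (hodd : odd d)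
    (hF : #|F| = (q ^ 2)%N) (htheta : forall x : F, theta x = x ^+ q)
    (hdim : \dim {:vT} = (2 * d)%N) (hform : nondegenerate form)
    (hS : EKR_set form S) :
  (#|S| <= ((q ^ 2 + q + 1) * q ^ (2 * d - 3) + 1) *
           \prod_(1 <= i < d | (2 * i != d - 1) && (2 * i != d + 1))
             (q ^ (2 * i - 1) + 1))%N.
Proof.
have q_gt1 : (1 < q)%N.
  case: hq => p [k [p_prime k_gt0 ->]].
  by rewrite -(exp1n k) ltn_exp2r // prime_gt1.
have [d_gt1 d_gt0] : (1 < d)%N /\ (0 < d)%N by lia.
case: hS => genS meetS; set gn := gens d form.
have S_gens G : G \in S -> G \in gn.
  by move=> GS; apply: (generator_gens q_gt1 hF htheta) => //; apply: genS.
have [->|[G0 G0S]] := set_0Vmem S; first by rewrite cards0.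
have [n card_gn] : exists n, #|gn| = n.+1.
  by exists #|gn|.-1; rewrite prednK //; apply/card_gt0P; exists G0; apply: S_gens.
pose g (i : 'I_n.+1) := enum_val (cast_ord (esym card_gn) i).
have g_gens i : g i \in gn by apply: enum_valP.
have g_inj : injective g by move=> i j /enum_val_inj/cast_ord_inj.
have g_surj G : G \in gn -> exists i, g i = G.
  move=> Ggn; exists (cast_ord card_gn (enum_rank_in Ggn G)).
  by rewrite /g cast_ordK enum_rankK_in.
pose delta i j := \dim (g i :&: g j).
have dim_g i : \dim (g i) = d by apply: gens_dim (g_gens i).
have deltaC i j : delta i j = delta j i by rewrite /delta capvC.
have delta_le i j : (delta i j <= d)%N by rewrite -(dim_g i) dimvS // capvSl.
have delta_eq i j : (delta i j == d) = (i == j).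
  apply/eqP/eqP => [dd|->]; last by rewrite /delta capvv.
  apply: g_inj; transitivity (g i :&: g j)%VS.
    by apply/esym/eqP; rewrite eqEdim capvSl dim_g -/(delta i j) dd /=.
  by apply/eqP; rewrite eqEdim capvSr dim_g -/(delta i j) dd /=.
have delta_sum i j (f : nat -> rat) :
    \sum_(k | delta i k == d.-1) f (delta k j) = neighbour_op q%:R d f (delta i j).
  rewrite -(neighbour_sum q_gt1 hF htheta hdim hform d_gt0 f (g_gens i) (g_gens j)).
  rewrite big_enum_val_cond /=.
  rewrite [RHS](reindex (cast_ord (esym card_gn))) //; apply: onW_bij.
  exists (cast_ord card_gn); [exact: cast_ordKV | exact: cast_ordK].
pose T := [set i | g i \in S].
have cardT : #|T| = #|S|.
  rewrite -(card_imset T g_inj); apply: eq_card => G.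
  apply/imsetP/idP => [[i] iT ->|GS]; first by move: iT; rewrite inE.
  by have [i gi] := g_surj G (S_gens G GS); exists i; rewrite ?inE gi.
have q_ge2 : 2 <= q%:R :> rat by rewrite ler_nat.
have T_meet : {in T &, forall i j, (0 < delta i j)%N}.
  move=> i j; rewrite !inE => iS jS.
  by rewrite lt0n dimv_eq0; apply: meetS.
have := scheme_ekr_bound q_ge2 d_gt1 deltaC delta_le delta_eq delta_sum hodd T_meet.
rewrite cardT qpoch_product // mulrA ekr_balance // mulrC -mulrA.
rewrite (ler_pM2l (ekr_poly_top_gt0 q_ge2 d_gt1)) => le_S.
rewrite -(ler_nat rat); apply: le_trans le_S _.
by rewrite [leRHS]natrM !natrD natrM !natrD !natrX.
Qed.
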